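(* Let $U$ be a graph with vertex set $V$. The following are equivalent: (1) there exist two graphs $G$ and $G'$ on vertex set $V$ having the same $3$-element homogeneous subsets such that $U=G\dot{+}G'$; (2) the edge-graphs $S(U)$ and $S(\overline{U})$ are both bipartite; (3) either $U$ is isomorphic to an induced subgraph of $P_9$, or the connected components of $U$, or the connected components of $\overline{U}$, are all cycles of even length or paths.
   Context: Graphs are undirected, simple and loopless; $\overline{U}$ is the complement of $U$. A subset of vertices of a graph $G$ is homogeneous if it is a clique or an independent set of $G$; the $3$-element homogeneous subsets of $G$ are the $3$-element vertex sets on which $G$ induces $K_3$ or its complement. For graphs $G,G'$ on the same vertex set $V$, the Boolean sum $G\dot{+}G'$ is the graph on $V$ whose edge set is the symmetric difference $E(G)\,\Delta\, E(G')$. For a graph $U$ on $V$, the edge-graph $S(U)$ is the graph whose vertices are the edges of $U$, two edges $u,v$ of $U$ being adjacent in $S(U)$ iff $u=xy$ and $v=xz$ for three distinct vertices $x,y,z\in V$ such that $yz$ is not an edge of $U$. $P_9$ is the Paley graph on $9$ vertices, isomorphic to $K_3\Box K_3$ (vertices $(i,j)$, $i,j\in\{1,2,3\}$, two distinct vertices adjacent iff they agree in exactly one coordinate). *)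

(* Defs.v *)
From mathcomp Require Import all_boot all_algebra.
From mathcomp Require Import boolp classical_sets.
From Stdlib Require Import Relation_Operators.

Set Implicit Arguments.
Unset Strict Implicit.
Unset Printing Implicit Defensive.

Local Open Scope classical_set_scope.

(* The vertex set is an arbitrary type: no finiteness is assumed. *)
Record graph (V : Type) := Graph {
  adj : V -> V -> Prop;
  adj_sym : forall x y, adj x y -> adj y x;
  adj_irr : forall x, ~ adj x x }.

Lemma compl_sym V (U : graph V) x y :
  x <> y /\ ~ adj U x y -> y <> x /\ ~ adj U y x.
Proof. by case=> nxy nU; split=> [e|e]; [apply: nxy|apply/nU/adj_sym]. Qed.

Lemma compl_irr V (U : graph V) x : ~ (x <> x /\ ~ adj U x x).
Proof. by case. Qed.

Definition compl V (U : graph V) : graph V :=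
  Graph (@compl_sym V U) (@compl_irr V U).

Lemma bsum_sym V (G G' : graph V) x y :
  (adj G x y /\ ~ adj G' x y) \/ (adj G' x y /\ ~ adj G x y) ->
  (adj G y x /\ ~ adj G' y x) \/ (adj G' y x /\ ~ adj G y x).
Proof.
by case=> -[e n]; [left|right]; split=> [|h]; by [exact: adj_sym|exact: n (adj_sym h)].
Qed.

Lemma bsum_irr V (G G' : graph V) x :
  ~ ((adj G x x /\ ~ adj G' x x) \/ (adj G' x x /\ ~ adj G x x)).
Proof. by case=> -[e n]; exact: adj_irr e. Qed.

Definition bsum V (G G' : graph V) : graph V :=
  Graph (@bsum_sym V G G') (@bsum_irr V G G').

Definition clique V (G : graph V) (A : set V) : Prop :=
  forall x y, A x -> A y -> x <> y -> adj G x y.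

Definition independent V (G : graph V) (A : set V) : Prop :=
  forall x y, A x -> A y -> ~ adj G x y.

Definition homogeneous V (G : graph V) (A : set V) : Prop :=
  clique G A \/ independent G A.

Definition three_element V (A : set V) : Prop :=
  exists x y z, [/\ x <> y, x <> z, y <> z & A = [set x; y; z]].

Definition same_3homogeneous V (G G' : graph V) : Prop :=
  forall A : set V, three_element A -> (homogeneous G A <-> homogeneous G' A).

Definition bipartite V (G : graph V) : Prop :=
  exists A B : set V, [/\ A `|` B = setT, A `&` B = set0,
    independent G A & independent G B].

(* Edges as two-element vertex sets, so that xy and yx are the same edge. *)
Definition edge V (U : graph V) : Type :=
  {e : set V | exists x y, adj U x y /\ e = [set x; y]}.

Definition edge_adj V (U : graph V) (u v : edge U) : Prop :=
  exists x y z, [/\ x <> y, x <> z & y <> z] /\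
    [/\ sval u = [set x; y], sval v = [set x; z] & ~ adj U y z].

Lemma edge_adj_sym V (U : graph V) (u v : edge U) :
  edge_adj u v -> edge_adj v u.
Proof.
case=> x [y [z [[nxy nxz nyz] [eu ev nU]]]]; exists x, z, y.
by split; split=> // e; [apply: nyz|apply/nU/adj_sym].
Qed.

Lemma edge_adj_irr V (U : graph V) (u : edge U) : ~ edge_adj u u.
Proof.
case=> x [y [z [[nxy nxz nyz] [-> /seteqP[sub _] _]]]].
by case: (sub y (or_intror erefl)) => [/esym|].
Qed.

Definition edge_graph V (U : graph V) : graph (edge U) :=
  Graph (@edge_adj_sym V U) (@edge_adj_irr V U).

Definition induced V (G : graph V) (W : set V) : graph {x | W x} :=
  @Graph {x | W x} (fun x y => adj G (sval x) (sval y))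
    (fun x y => @adj_sym V G (sval x) (sval y))
    (fun x => @adj_irr V G (sval x)).

Definition isomorphic V W (G : graph V) (H : graph W) : Prop :=
  exists f : V -> W, bijective f /\ forall x y, adj G x y <-> adj H (f x) (f y).

Lemma P9_sym (p q : 'I_3 * 'I_3) :
  (p.1 = q.1 /\ p.2 <> q.2) \/ (p.1 <> q.1 /\ p.2 = q.2) ->
  (q.1 = p.1 /\ q.2 <> p.2) \/ (q.1 <> p.1 /\ q.2 = p.2).
Proof. by case=> -[e n]; [left|right]; split=> // h; [apply: n|apply: e]. Qed.

Lemma P9_irr (p : 'I_3 * 'I_3) :
  ~ ((p.1 = p.1 /\ p.2 <> p.2) \/ (p.1 <> p.1 /\ p.2 = p.2)).
Proof. by case=> -[]. Qed.

Definition P9 : graph ('I_3 * 'I_3) := Graph P9_sym P9_irr.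

(* The symmetric, loopless closure of a successor relation s. *)
Lemma succ_sym T (s : T -> T -> Prop) x y :
  x <> y /\ (s x y \/ s y x) -> y <> x /\ (s y x \/ s x y).
Proof. by case=> nxy /or_comm s_yx; split=> // e; apply: nxy. Qed.

Lemma succ_irr T (s : T -> T -> Prop) x : ~ (x <> x /\ (s x x \/ s x x)).
Proof. by case. Qed.

Definition succ_graph T (s : T -> T -> Prop) : graph T :=
  Graph (@succ_sym T s) (@succ_irr T s).

Definition cycle_graph n : graph 'I_n :=
  succ_graph (fun i j : 'I_n => nat_of_ord j = i.+1 %% n).

Definition path_graph n : graph 'I_n :=
  succ_graph (fun i j : 'I_n => nat_of_ord j = i.+1).

Definition ray_graph : graph nat := succ_graph (fun i j => j = i.+1).

Definition double_ray_graph : graph int :=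
  succ_graph (fun i j : int => j = (i + 1)%R).

Definition is_even_cycle V (G : graph V) : Prop :=
  exists n, [/\ 3 <= n, ~~ odd n & isomorphic G (cycle_graph n)].

(* As vertex sets may be infinite, paths are the finite paths (a single vertex
   included) together with the one-way and the two-way infinite path. *)
Definition is_path V (G : graph V) : Prop :=
  [\/ exists n, 1 <= n /\ isomorphic G (path_graph n),
      isomorphic G ray_graph | isomorphic G double_ray_graph].

Definition is_component V (G : graph V) (C : set V) : Prop :=
  exists x, C = [set y | clos_refl_trans V (adj G) x y].

Definition components_even_cycles_or_paths V (G : graph V) : Prop :=
  forall C : set V, is_component G C ->
    is_even_cycle (induced G C) \/ is_path (induced G C).

Definition embeds_in_P9 V (U : graph V) : Prop :=
  exists W : set ('I_3 * 'I_3), isomorphic U (induced P9 W).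

(* Main.v *)
Require Import Defs.
From mathcomp Require Import all_boot all_algebra.
From mathcomp Require Import boolp classical_sets.
From mathcomp Require Import zify.
From Stdlib Require Import Relation_Operators.

(** Taking the edges of G as one colour class, conditions (1) and (2) both say
    that the pairs of vertices can be 2-coloured so that in every triple on
    which U is neither complete nor empty, the two pairs of the same kind (edge
    or non-edge of U) get different colours.

    If U is triangle-free, each vertex then has at most one edge of each colour,
    so the components of U are traced by walks alternating between the two
    colours; dually for the complement. Otherwise U has a triangle and an
    independent triple; a counting argument makes them share a vertex, and
    they then span an induced bull. The colouring of a bull is unique up to
    renaming and identifies it with five points of the affine plane over F_3,
    whose four directions are the two colours of edges and the two colours of
    non-edges. A finite check shows that every other vertex sits at one of the
    four remaining points, and that two vertices at points p and p' are
    distinct and related as p and p' are.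

    Conversely, the directions of the plane colour P_9, and a graph whose
    components are even cycles and paths is coloured by parities along them. *)

Set Implicit Arguments.
Unset Strict Implicit.
Unset Printing Implicit Defensive.

Local Open Scope classical_set_scope.

(** * Pair colourings and bipartite edge-graphs *)

(** A proper 2-colouring of the edge-graph, written as a function on all pairs of vertices; its
    values off the edges of [U] are unconstrained. *)
Definition separates V (U : graph V) (g : V -> V -> bool) : Prop :=
  forall x y z, y <> z -> adj U x y -> adj U x z -> ~ adj U y z ->
    g x y <> g x z.

Definition pair_colouring V (U : graph V) (g : V -> V -> bool) : Prop :=
  [/\ forall x y, g x y = g y x, separates U g & separates (compl U) g].

Lemma graph_ext V (G H : graph V) : (forall x y, adj G x y <-> adj H x y) -> G = H.
Proof.
case: G H => [a s i] [a' s' i'] /= e.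
have ea : a = a' by apply/funext => x; apply/funext => y; apply/propext.
subst a'; by rewrite (Prop_irrelevance s s') (Prop_irrelevance i i').
Qed.

Lemma complK V (U : graph V) : compl (compl U) = U.
Proof.
apply: graph_ext => x y /=; split=> [[nxy h]|h].
  by apply: contrapT => nU; apply: h.
by split=> [e|[]//]; apply: (@adj_irr _ U x); rewrite {2}e.
Qed.

Lemma adj_neq V (U : graph V) x y : adj U x y -> x <> y.
Proof. by move=> h e; apply: (@adj_irr _ U x); rewrite {2}e. Qed.

(** Complementation merely exchanges the two separation conditions, so every argument about [U] can
    be dualised. *)
Lemma pair_colouring_compl V (U : graph V) g :
  pair_colouring U g -> pair_colouring (compl U) g.
Proof. by case=> sg s s'; split=> //; rewrite complK. Qed.

Lemma set2_eq T (x y x' y' : T) : [set x; y] = [set x'; y'] ->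
  (x = x' /\ y = y') \/ (x = y' /\ y = x').
Proof.
move=> /seteqP[s s'].
have hx : x = x' \/ x = y' := s x (or_introl erefl).
have hy : y = x' \/ y = y' := s y (or_intror erefl).
have hx' : x' = x \/ x' = y := s' x' (or_introl erefl).
have hy' : y' = x \/ y' = y := s' y' (or_intror erefl).
case: hx => ?; case: hy => ?; case: hx' => ?; case: hy' => ?; subst; tauto.
Qed.

Lemma sval_inj T (P : T -> Prop) (u v : {x | P x}) : sval u = sval v -> u = v.
Proof.
by case: u v => [x hx] [y hy] /= xy; subst y; rewrite (Prop_irrelevance hx hy).
Qed.

(** A class [A] of a bipartition colours a pair by whether it is an edge in [A]; conversely the
    edges of colour [true] and their complement form a bipartition. *)
Lemma edge_bipartiteP V (U : graph V) : bipartite (edge_graph U) <->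
  exists2 g : V -> V -> bool, (forall x y, g x y = g y x) & separates U g.
Proof.
split=> [[A [B [AB AB0 iA iB]]]|[g sg sep]].
  exists (fun x y => `[< exists2 e : edge U, sval e = [set x; y] & A e >]).
    by move=> x y; rewrite setUC.
  move=> x y z nyz xy xz yz.
  have exy : exists x' y', adj U x' y' /\ [set x; y] = [set x'; y'].
    by exists x, y.
  have exz : exists x' y', adj U x' y' /\ [set x; z] = [set x'; y'].
    by exists x, z.
  pose e : edge U := exist _ _ exy; pose f : edge U := exist _ _ exz.
  have ef : edge_adj e f.
    by exists x, y, z; split; split=> //; [exact: adj_neq xy|exact: adj_neq xz].
  have B_of u : ~ A u -> B u.
    by move=> nA; have : (A `|` B) u by [rewrite AB]; case.
  have AE (u : edge U) w t : sval u = [set w; t] ->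
      `[< exists2 e : edge U, sval e = [set w; t] & A e >] = `[< A u >].
    move=> uw; apply/asbool_equiv_eq; split=> [[v vw]|Au]; last by exists u.
    by rewrite (@sval_inj _ _ u v) // uw.
  rewrite (AE e) // (AE f) //; case: (asboolP (A e)) => Ae; case: asboolP => Af // _.
    exact: iA ef.
  by apply: iB ef; apply: B_of.
pose A := [set e : edge U | exists x y, sval e = [set x; y] /\ g x y].
have AE (e : edge U) x y : sval e = [set x; y] -> A e <-> g x y.
  move=> exy; split=> [[x' [y' [exy' gxy]]]|]; last by exists x, y.
  by case: (set2_eq (etrans (esym exy) exy')) => -[-> ->] //; rewrite sg.
have sep' (e f : edge U) : edge_adj e f -> ~ (A e <-> A f).
  case=> x [y [z [[nxy nxz nyz] [exy fxz yz]]]].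
  rewrite (AE e x y) // (AE f x z) // => gg.
  have ad (h : edge U) t : sval h = [set x; t] -> adj U x t.
    move=> ht; case: (svalP h) => x' [y' [xy' hE]].
    by case: (set2_eq (etrans (esym ht) hE)) => -[-> ->] //; exact: adj_sym.
  apply: (sep x y z) => //; [exact: ad exy|exact: ad fxz|by apply/idP/idP => ?; apply/gg].
exists A, (~` A); split; [exact: setUv|exact: setICr| |].
- by move=> e f Ae Af /sep'; apply.
- by move=> e f Ae Af /sep'; apply.
Qed.

Lemma bipartite_pair_colouring V (U : graph V) :
  (bipartite (edge_graph U) /\ bipartite (edge_graph (compl U))) <->
  exists g, pair_colouring U g.
Proof.
rewrite !edge_bipartiteP; split=> [[[g sg h] [g' sg' h']]|[g [sg h h']]]; last first.
  by split; exists g.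
(* The two colourings are constrained on disjoint sets of pairs, hence can be glued. *)
exists (fun x y => if `[< adj U x y >] then g x y else g' x y); split.
- move=> x y; rewrite sg sg'; congr (if _ then _ else _).
  by apply/asbool_equiv_eq; split; exact: adj_sym.
- by move=> x y z nyz xy xz yz; rewrite !asboolT //; exact: h.
- move=> x y z nyz xy xz yz; rewrite !asboolF; first exact: h'.
    by case: xz.
  by case: xy.
Qed.

(** * Admissible triples and Boolean sums *)

Definition kind V (U : graph V) (g : V -> V -> bool) x y : bool * bool :=
  (`[< adj U x y >], g x y).

(** Here [p] and [q] are the kinds of two pairs with a common vertex, and [r] is the kind of the
    pair that closes the triple. Edges and non-edges are treated alike. *)
Definition fan (p q r : bool * bool) : bool :=
  (p.1 == q.1) && (p.1 != r.1) ==> (p.2 != q.2).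

Definition triangle_ok p q r := [&& fan p q r, fan p r q & fan q r p].

Lemma asbool_adj_sym V (U : graph V) x y : `[< adj U x y >] = `[< adj U y x >].
Proof. by apply/asbool_equiv_eq; split; exact: adj_sym. Qed.

Lemma kind_sym V (U : graph V) g x y : pair_colouring U g ->
  kind U g x y = kind U g y x.
Proof. by case=> sg _ _; rewrite /kind sg asbool_adj_sym. Qed.

Lemma kind_triangle V (U : graph V) g x y z : pair_colouring U g ->
  x <> y -> x <> z -> y <> z ->
  triangle_ok (kind U g x y) (kind U g x z) (kind U g y z).
Proof.
move=> gU nxy nxz nyz.
have H a b c : a <> b -> a <> c -> b <> c ->
    fan (kind U g a b) (kind U g a c) (kind U g b c).
  move=> nab nac nbc; case: gU => _ h h'; rewrite /fan /kind /=.
  apply/implyP; case: asboolP => ab; case: asboolP => ac; case: asboolP => bc // _.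
    exact/eqP/h.
  by apply/eqP/h' => // -[].
apply/and3P; split; first exact: H.
  by rewrite (kind_sym x y gU); apply: H => // /esym.
by rewrite (kind_sym x z gU) (kind_sym y z gU); apply: H => // /esym.
Qed.

Lemma pair_colouringP V (U : graph V) g :
  (forall x y, g x y = g y x) ->
  (forall x y z, x <> y -> x <> z -> y <> z ->
     fan (kind U g x y) (kind U g x z) (kind U g y z)) -> pair_colouring U g.
Proof.
move=> sg H; split=> // x y z nyz xy xz yz; apply/eqP.
  have := H x y z (adj_neq xy) (adj_neq xz) nyz; rewrite /fan /kind /=.
  by rewrite !(@asboolT (adj U x _)) // asboolF.
have := H x y z (adj_neq xy) (adj_neq xz) nyz; rewrite /fan /kind /=.
case: xy xz yz => _ xy [_ xz] yz; rewrite !(@asboolF (adj U x _)) // asboolT //.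
by apply: contrapT => yz'; apply: yz.
Qed.

Lemma homogeneous3 V (G : graph V) x y z : x <> y -> x <> z -> y <> z ->
  homogeneous G [set x; y; z] <->
  (`[< adj G x y >] == `[< adj G x z >]) && (`[< adj G x y >] == `[< adj G y z >]).
Proof.
move=> nxy nxz nyz; have sG := @adj_sym _ G; have iG := @adj_irr _ G.
have X : [set x; y; z] x by left; left.
have Y : [set x; y; z] y by left; right.
have Z : [set x; y; z] z by right.
split=> [[h|h]|].
- by rewrite !asboolT //; apply: h.
- by rewrite !asboolF //; apply: h.
case: asboolP => xy; case: asboolP => xz; case: asboolP => yz // _; [left|right].
  by move=> s t [[->|->]|->] [[->|->]|->] // _; apply: sG.
by move=> s t [[->|->]|->] [[->|->]|->] // /sG.
Qed.

Lemma asbool_bsum V (G G' : graph V) x y :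
  `[< adj (bsum G G') x y >] = `[< adj G x y >] (+) `[< adj G' x y >].
Proof.
rewrite /=; case: (asboolP (adj G x y)) => xy; case: (asboolP (adj G' x y)) => xy' /=;
  by [apply/asboolP; tauto|apply/asboolPn; tauto].
Qed.

(** Colour pairs by adjacency in [G]. If [xy] and [xz] agree in [U] but [yz] does not, equal colours
    on [xy] and [xz] would make the triple homogeneous in exactly one of [G] and [G']. Conversely
    the pairs of colour [true] form [G], and [G'] must be its sum with [U]. *)
Lemma boolean_sum_pair_colouring V (U : graph V) :
  (exists G G' : graph V, same_3homogeneous G G' /\ U = bsum G G') <->
  exists g, pair_colouring U g.
Proof.
split=> [[G [G' [hG ->]]]|[g gU]].
  exists (fun x y => `[< adj G x y >]); apply: pair_colouringP => [x y|].
    exact: asbool_adj_sym.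
  move=> x y z nxy nxz nyz; rewrite /fan /kind !asbool_bsum /=.
  have : homogeneous G [set x; y; z] <-> homogeneous G' [set x; y; z].
    by apply: hG; exists x, y, z.
  rewrite !homogeneous3 //.
  case: `[< adj G x y >]; case: `[< adj G x z >]; case: `[< adj G y z >];
  case: `[< adj G' x y >]; case: `[< adj G' x z >]; case: `[< adj G' y z >] => //=;
  by case=> h1 h2; try (by have := h1 isT); have := h2 isT.
have sg : forall x y, g x y = g y x by case: gU.
have G_sym x y : x <> y /\ g x y -> y <> x /\ g y x.
  by rewrite sg => -[nxy gyx]; split=> // e; apply: nxy.
have G_irr x : ~ (x <> x /\ g x x) by case.
pose G := Graph G_sym G_irr; exists G, (bsum G U).
have GE x y : x <> y -> `[< adj G x y >] = g x y.
  by move=> nxy; apply/asboolP/idP => [[]|].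
split; last first.
  apply: graph_ext => x y.
  suff e : `[< adj U x y >] = `[< adj (bsum G (bsum G U)) x y >].
    by split=> /asboolP; [rewrite e|rewrite -e] => /asboolP.
  by rewrite !asbool_bsum; case: asbool; case: asbool.
move=> _ [x [y [z [nxy nxz nyz ->]]]]; rewrite !homogeneous3 // !asbool_bsum !GE //.
have := kind_triangle gU nxy nxz nyz; rewrite /triangle_ok /fan /kind /=.
case: `[< adj U x y >]; case: `[< adj U x z >]; case: `[< adj U y z >];
case: (g x y); case: (g x z); case: (g y z) => //=.
Qed.

(** * Components traced by alternating walks *)

Notation component U x := [set y | clos_refl_trans _ (adj U) x y].

Lemma connected_sym V (U : graph V) x y :
  clos_refl_trans V (adj U) x y -> clos_refl_trans V (adj U) y x.
Proof.
elim=> [a b ab|a|a b c _ ba _ cb]; first exact/rt_step/adj_sym.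
  exact: rt_refl.
exact: rt_trans cb ba.
Qed.

Lemma component_eq V (U : graph V) x y :
  clos_refl_trans V (adj U) x y -> component U x = component U y.
Proof.
move=> xy; apply/seteqP; split=> z /=; last exact: rt_trans.
by apply: rt_trans; exact: connected_sym.
Qed.

(** Used with [h] a walk whose range is a component and [H] the model cycle or path. *)
Lemma isomorphic_range V I (U : graph V) (H : graph I) (h : I -> V) (C : set V) :
  injective h -> (forall x, C x <-> exists i, h i = x) ->
  (forall i j, adj H i j <-> adj U (h i) (h j)) -> isomorphic (induced U C) H.
Proof.
move=> hI hC hU.
have ex (x : {x | C x}) : exists i, h i = sval x by apply/hC/svalP.
pose f x := sval (cid (ex x)); have fE x : h (f x) = sval x := svalP (cid (ex x)).
have hP i : C (h i) by apply/hC; exists i.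
exists f; split=> [|x y]; last by rewrite hU !fE.
exists (fun i => exist _ (h i) (hP i)) => [x|i]; last by apply: hI; rewrite fE.
exact/sval_inj/fE.
Qed.

Section Walk.

(* [m b] swaps the two ends of each edge of colour [b] and fixes the vertices
   that are on no such edge. *)
Variables (V : Type) (U : graph V) (m : bool -> V -> V).
Hypothesis mK : forall b, involutive (m b).
Hypothesis m_double : forall x, m true x = m false x -> m true x = x.
Hypothesis adjE : forall x y, adj U x y <-> x <> y /\ exists b, m b x = y.

Lemma m_adj b x : m b x <> x -> adj U x (m b x).
Proof. by move=> n; apply/adjE; split; [move/esym|exists b]. Qed.

Lemma m_connected b x : clos_refl_trans V (adj U) x (m b x).
Proof.
case: (pselect (m b x = x)) => [->|/m_adj]; [exact: rt_refl|exact: rt_step].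
Qed.

(** A range closed under both involutions is closed under adjacency, so it cannot miss part of the
    component. *)
Lemma component_of_walk I (h : I -> V) i0 :
  (forall i c, exists j, m c (h i) = h j) ->
  (forall i, clos_refl_trans V (adj U) (h i0) (h i)) ->
  forall x, component U (h i0) x <-> exists i, h i = x.
Proof.
move=> cl co x; split=> [|[i <-]]; last exact: co.
suff st a b : clos_refl_trans V (adj U) a b -> (exists i, h i = a) -> exists i, h i = b.
  by move=> /st; apply; exists i0.
elim=> [{}a {}b /adjE[_ [c <-]] [i <-]|//|a' b' c' _ ab _ bc /ab/bc//].
by case: (cl i c) => j ->; exists j.
Qed.

Section NatWalk.

Variables (b : bool) (x0 : V).
Hypothesis x0_end : m (~~ b) x0 = x0.

(** The colours of the steps alternate, beginning with [b]. At a far end the walk stays put for one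
    step and then turns back. *)
Fixpoint walk n := if n is n'.+1 then m (b (+) odd n') (walk n') else x0.

(** One colour leads forward and the other back. At [i = 0] the latter is [~~ b], which fixes [x0],
    in accordance with [0.-1 = 0]. *)
Lemma m_walk c i : m c (walk i) = if c == b (+) odd i then walk i.+1 else walk i.-1.
Proof.
case: eqP => [->//|]; case: i => [|i] /= nc.
  by have -> : c = ~~ b by [move: nc; case: c; case: (b)].
by have -> : c = b (+) odd i by [move: nc; case: c; case: (b); case: odd]; rewrite mK.
Qed.

Lemma walk_connected n : clos_refl_trans V (adj U) x0 (walk n).
Proof.
elim: n => [|n IH]; first exact: rt_refl.
exact: rt_trans IH (m_connected _ _).
Qed.

(** Descent: undoing the last step of a coincidence gives one with a smaller last position, the
    other position moving by one up or down according to parity. The descent can only end at a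
    stationary step. *)
Lemma walk_neq j : (forall k, k < j -> walk k.+1 <> walk k) ->
  forall i, i < j -> walk i <> walk j.
Proof.
elim/ltn_ind: j => -[//|j] IH st i ij e.
(* This is the colour of the step into position [j.+1]; applying it again undoes that step. *)
have := m_walk (b (+) odd j) i; rewrite e m_walk.
have -> : (b (+) odd j == b (+) odd j.+1) = false by rewrite /=; case: (b); case: odd.
rewrite succnK; case: eqP => oj.
  have {}oj : odd i = odd j by move: oj; case: (b); case: odd; case: odd.
  have [ji|ji] := ltnP i.+1 j.
    by move/esym; apply: IH => // k kj; apply: st; lia.
  have ij' : i = j by lia.
  by move=> _; apply: (st j) => //; rewrite -e ij'.
have {}oj : odd i = ~~ odd j by move: oj; case: (b); case: odd; case: odd.
case: i => [|i] in ij e oj *.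
  by move=> e0; apply: (st j) => //; rewrite -e e0.
by move/esym; apply: IH; [|move=> k kj; apply: st|]; lia.
Qed.

Lemma walk_adj i j : adj U (walk i) (walk j) ->
  walk j = walk i.+1 \/ 0 < i /\ walk j = walk i.-1.
Proof.
move=> /adjE[n [c]]; rewrite m_walk; case: eqP => _ ij; [by left|right].
by split=> //; case: i n ij => // n /esym.
Qed.

Lemma walk_is_path : is_path (induced U (component U x0)).
Proof.
case: (pselect (exists k, walk k.+1 = walk k)) => [ex|nex].
  have ex' : exists k, `[< walk k.+1 = walk k >] by case: ex => k; exists k; apply/asboolP.
  (* The first stationary step marks the far end, so the path has the [N.+1] vertices at positions
     up to [N]. *)
  pose N := ex_minn ex'.
  have /asboolP NE : `[< walk N.+1 = walk N >] by rewrite /N; case: ex_minnP.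
  have Nmin k : k < N -> walk k.+1 <> walk k.
    rewrite /N; case: ex_minnP => n _ h kn /asboolP/h; lia.
  have winj i j : i <= N -> j <= N -> walk i = walk j -> i = j.
    move=> iN jN; case: (ltngtP i j) => // ij.
      by move=> e; exfalso; apply: walk_neq ij e => k kj; apply: Nmin; lia.
    by move/esym => e; exfalso; apply: walk_neq ij e => k kj; apply: Nmin; lia.
  apply: Or31; exists N.+1; split=> //.
  apply: (@isomorphic_range _ _ _ _ (fun i : 'I_N.+1 => walk i)).
  - by move=> i j /winj e; apply/val_inj/e; rewrite -ltnS.
  - apply: (component_of_walk (i0 := ord0)) => [i c|i]; last exact: walk_connected.
    rewrite m_walk; case: eqP => _.
      have [iN|iN] := ltnP i N.
        by exists (@Ordinal N.+1 i.+1 iN).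
      by exists i; have -> : nat_of_ord i = N by have := ltn_ord i; lia.
    have iN : i.-1 < N.+1 by have := ltn_ord i; lia.
    by exists (Ordinal iN).
  - move=> i j; have [iN jN] : i <= N /\ j <= N by split; rewrite -ltnS.
    split=> [[nij ij]|ij].
      have st (k l : 'I_N.+1) : nat_of_ord l = k.+1 -> adj U (walk k) (walk l).
        by move=> e; rewrite e; apply/m_adj/Nmin; have := ltn_ord l; lia.
      by case: ij => /st //; exact: adj_sym.
    have nij : i <> j by move=> e; move: (adj_neq ij); rewrite e.
    split=> //; case: (walk_adj ij) => [e|[i0 e]].
      have [iN'|iN'] := ltnP i N; first by left; apply: (@winj j i.+1).
      case: nij; apply/val_inj/esym; apply: (@winj j i) => //; rewrite e.
      by have -> : nat_of_ord i = N by lia.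
    by right; have := winj j i.-1 jN; rewrite e => /(_ _ erefl) h; lia.
have st k : walk k.+1 <> walk k by move=> e; apply: nex; exists k.
have winj : injective walk.
  move=> i j; case: (ltngtP i j) => // ij; first by move=> e; exfalso; apply: walk_neq ij e.
  by move/esym => e; exfalso; apply: walk_neq ij e.
apply: Or32; apply: (isomorphic_range winj).
- apply: (component_of_walk (i0 := 0)) => [i c|i]; last exact: walk_connected.
  by rewrite m_walk; case: eqP; [exists i.+1|exists i.-1].
- move=> i j; split=> [[nij [->|->]]|ij]; first exact/m_adj/st.
    exact/adj_sym/m_adj/st.
  split=> [e|]; first by move: (adj_neq ij); rewrite e.
  by case: (walk_adj ij) => [/winj|[i0 /winj]]; [left|right; lia].
Qed.

End NatWalk.

Section IntWalk.

Variable x0 : V.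
Hypothesis no_end : forall x, clos_refl_trans V (adj U) x0 x -> forall c, m c x <> x.

Local Open Scope ring_scope.

(** Two walks leave [x0] by different colours, one for each sign. As [Negz n] is [-(n+1)], the
    negative side starts at [n.+1], and the step from [i] to [i + 1] has colour [par i]
    everywhere. *)
Definition int_walk (i : int) : V :=
  match i with Posz n => walk false x0 n | Negz n => walk true x0 n.+1 end.

Notation par i := (odd (absz i)).

Lemma int_walkS i : int_walk (i + 1) = m (par i) (int_walk i).
Proof.
case: i => [n|[|n]].
- by have -> : Posz n + 1 = Posz n.+1 by lia.
- by rewrite /= mK.
- have -> : Negz n.+1 + 1 = Negz n by lia.
  by rewrite /= negbK mK.
Qed.

Lemma parS i : par (i + 1) = ~~ par i. Proof. lia. Qed.

Lemma m_int_walk c i :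
  m c (int_walk i) = if c == par i then int_walk (i + 1) else int_walk (i - 1).
Proof.
rewrite int_walkS; case: eqP => [->//|nc].
have := int_walkS (i - 1); rewrite GRing.subrK => ->.
have -> : c = par (i - 1) by have := parS (i - 1); rewrite GRing.subrK; lia.
by rewrite mK.
Qed.

Lemma int_walk_connected i : clos_refl_trans V (adj U) x0 (int_walk i).
Proof. by case: i => n; exact: walk_connected. Qed.

Lemma int_walk_step i : int_walk (i + 1) <> int_walk i.
Proof. by rewrite int_walkS; apply: no_end; exact: int_walk_connected. Qed.

Lemma int_walk_shift i j (k : nat) : par i = par j ->
  int_walk i = int_walk j -> int_walk (i + k%:Z) = int_walk (j + k%:Z).
Proof.
elim: k => [|k IH] pij ij; first by rewrite !GRing.addr0.
have -> : i + k.+1%:Z = (i + k%:Z) + 1 by lia.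
have -> : j + k.+1%:Z = (j + k%:Z) + 1 by lia.
by rewrite !int_walkS IH //; congr (m _ _); lia.
Qed.

Lemma int_walk_shiftN i j (k : nat) : par i = par j ->
  int_walk i = int_walk j -> int_walk (i - k%:Z) = int_walk (j - k%:Z).
Proof.
elim: k => [|k IH] pij ij; first by rewrite !GRing.subr0.
have := m_int_walk (~~ par (i - k%:Z)) (i - k%:Z); rewrite IH // m_int_walk.
have -> : par (i - k%:Z) = par (j - k%:Z) by lia.
have -> : (~~ par (j - k%:Z) == par (j - k%:Z)) = false by case: odd.
have -> : i - k.+1%:Z = (i - k%:Z) - 1 by lia.
by have -> : j - k.+1%:Z = (j - k%:Z) - 1 by lia.
Qed.

(** At odd distance the colour that leads forward from the first position leads back from the
    second. The two approach each other by 2 until they are consecutive, which would be a stationary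
    step. *)
Lemma int_walk_odd i (d : nat) : odd d -> int_walk i <> int_walk (i + d%:Z).
Proof.
move=> od; have -> : d = (d./2.*2).+1 by lia.
elim: (d./2) i => [|k IH] i e; first exact: (@int_walk_step i).
apply: (IH (i + 1)); rewrite int_walkS e m_int_walk.
have -> : (par i == par (i + (k.+1.*2.+1)%:Z)) = false by lia.
by congr int_walk; lia.
Qed.

(** At even distance the two positions have the same parity, so the coincidence can be translated to
    0. *)
Lemma int_walk_eq i (d : nat) :
  int_walk i = int_walk (i + d%:Z) -> int_walk 0 = int_walk d%:Z /\ ~~ odd d.
Proof.
move=> e; have ed : ~~ odd d by apply/negP => od; exact: int_walk_odd od e.
split=> //; have pe : par i = par (i + d%:Z) by lia.
case: i => n in e pe *.
  have := int_walk_shiftN n pe e.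
  by rewrite GRing.subrr; have -> : Posz n + d%:Z - n%:Z = d by lia.
have := int_walk_shift n.+1 pe e.
by have [-> ->] : Negz n + n.+1%:Z = 0 /\ Negz n + d%:Z + n.+1%:Z = d by split; lia.
Qed.

Lemma int_walk_adj i j : adj U (int_walk i) (int_walk j) ->
  int_walk j = int_walk (i + 1) \/ int_walk j = int_walk (i - 1).
Proof. by move=> /adjE[n [c]]; rewrite m_int_walk; case: eqP => _; [left|right]. Qed.

Lemma int_walk_is_cycle_or_path :
  is_even_cycle (induced U (component U x0)) \/ is_path (induced U (component U x0)).
Proof.
case: (pselect (exists n : nat, int_walk n.+1%:Z = int_walk 0)) => [ex|nex]; [left|right].
  have ex' : exists k : nat, `[< int_walk k.+1%:Z = int_walk 0 >].
    by case: ex => k; exists k; apply/asboolP.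
  (* The least positive return time to [x0] is [N.+1], the length of the cycle. *)
  pose N := ex_minn ex'.
  have /asboolP NE : `[< int_walk N.+1%:Z = int_walk 0 >] by rewrite /N; case: ex_minnP.
  have Nmin k : (k < N)%N -> int_walk k.+1%:Z <> int_walk 0.
    rewrite /N; case: ex_minnP => n _ h kn /asboolP/h; lia.
  have [_ eN] : int_walk 0 = int_walk N.+1%:Z /\ ~~ odd N.+1.
    by apply: (@int_walk_eq 0); rewrite GRing.add0r.
  have N1 : N <> 1%N.
    (* A return after two steps would make both colours lead from [int_walk 1] to [x0], which
       [m_double] allows only for a fixed vertex. *)
    move=> N1; move: NE; rewrite N1 => e.
    have e1 := int_walkS 0; have e2 := int_walkS 1.
    move: e2; rewrite (_ : (1 + 1)%R = 2%:Z :> int) // e => e2.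
    move: e1; rewrite GRing.add0r => e1.
    have {}e1 : m false (int_walk 1) = int_walk 0 by rewrite e1 mK.
    apply: (no_end (int_walk_connected 1) (c := true)).
    by apply: m_double; rewrite e1 e2.
  have N3 : (3 <= N.+1)%N by case: (N) eN N1 => [//|[//|n]].
  have winj (i j : nat) : (i <= N)%N -> (j <= N)%N -> int_walk i = int_walk j -> i = j.
    wlog ij : i j / (i < j)%N => [H iN jN|iN jN].
      by case: (ltngtP i j) => // ij; [exact: H|move=> /esym/H-> ].
    have {1}-> : Posz j = i%:Z + (j - i)%N%:Z by lia.
    move=> /int_walk_eq[/esym]; have {1}-> : (j - i)%N = (j - i).-1.+1 by lia.
    by move=> /Nmin; case; lia.
  have wmod (i : nat) : (i <= N)%N -> int_walk (i%:Z + 1) = int_walk (i.+1 %% N.+1)%N.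
    move=> iN; have -> : i%:Z + 1 = i.+1%:Z by lia.
    have [iN'|iN'] := ltnP i N; first by rewrite modn_small.
    have -> : i = N by lia.
    by rewrite modnn.
  have wpred : int_walk (0 - 1) = int_walk N%:Z.
    have := @int_walk_shiftN 0 N.+1 1; rewrite NE => -> //; last by lia.
    by congr int_walk; lia.
  exists N.+1; split=> //.
  apply: (@isomorphic_range _ _ _ _ (fun i : 'I_N.+1 => int_walk (nat_of_ord i)%:Z)).
  - by move=> i j /winj e; apply/val_inj/e; rewrite -ltnS.
  - apply: (component_of_walk (i0 := ord0)) => [i c|i]; last exact: int_walk_connected.
    have iN : (i <= N)%N by rewrite -ltnS.
    rewrite m_int_walk; case: eqP => _.
      by rewrite wmod //; exists (Ordinal (ltn_pmod i.+1 (ltn0Sn N))).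
    case: (nat_of_ord i) iN => [|k] kN; first by exists ord_max; rewrite wpred.
    have kN' : (k < N.+1)%N by lia.
    by exists (Ordinal kN'); congr int_walk => /=; lia.
  - move=> i j; have [iN jN] : (i <= N)%N /\ (j <= N)%N by split; rewrite -ltnS.
    have st (k l : 'I_N.+1) : nat_of_ord l = (k.+1 %% N.+1)%N ->
        adj U (int_walk k) (int_walk l).
      move=> ->; rewrite -wmod; last by rewrite -ltnS.
      rewrite int_walkS; apply: m_adj.
      by apply: no_end; exact: int_walk_connected.
    split=> [[nij [/st//|h]]|ij]; first exact/adj_sym/st.
    split=> [e|]; first by move: (adj_neq ij); rewrite e.
    have wE (k l : nat) : (k <= N)%N -> (l <= N)%N ->
        int_walk l = int_walk (k%:Z + 1) -> l = (k.+1 %% N.+1)%N.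
      by move=> kN lN; rewrite wmod // => /winj; apply=> //; rewrite -ltnS ltn_pmod.
    case: (int_walk_adj ij) => [/wE|e]; [by left; auto|right; apply: wE => //].
    case: (nat_of_ord i) iN e => [|k] kN e.
      by move: e; rewrite wpred => /winj ->//; rewrite -NE; congr int_walk; lia.
    have {}e : int_walk j = int_walk k by rewrite e; congr int_walk; lia.
    by rewrite (winj _ _ _ _ e) //; [congr int_walk|]; lia.
have winj : injective int_walk.
  move=> i j; wlog ij : i j / (i < j)%R => [H|].
    have [ij|[ij|//]] : (i < j \/ j < i \/ i = j)%R by lia.
      exact: H.
    by move=> /esym/H->.
  have {1}-> : j = i + (`|j - i|.-1.+1)%N%:Z by lia.
  by move=> /int_walk_eq[/esym e _]; case: nex; exists `|j - i|.-1.
apply: Or33; apply: (isomorphic_range winj).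
- apply: (component_of_walk (i0 := 0)) => [i c|i]; last exact: int_walk_connected.
  by rewrite m_int_walk; case: eqP; [exists (i + 1)|exists (i - 1)].
- move=> i j.
  have st k : adj U (int_walk k) (int_walk (k + 1)).
    rewrite int_walkS; apply/m_adj/no_end; exact: int_walk_connected.
  split=> [[nij [->|->]]|ij]; [exact: st|exact/adj_sym/st|].
  split=> [e|]; first by move: (adj_neq ij); rewrite e.
  by case: (int_walk_adj ij) => /winj; [left|right; lia].
Qed.

End IntWalk.

Lemma matchings_cycles_or_paths : components_even_cycles_or_paths U.
Proof.
move=> C [x ->].
case: (pselect (exists2 y, clos_refl_trans V (adj U) x y & exists b, m b y = y)).
  case=> y xy [b yb]; rewrite (component_eq xy); right.
  (* The walk starts at [y] with the only colour that may move it. *)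
  by apply: (@walk_is_path (~~ b)); rewrite negbK.
move=> nex; apply: int_walk_is_cycle_or_path => y xy c yc.
by apply: nex; exists y => //; exists c.
Qed.

End Walk.

Lemma triangle_free_cycles_or_paths V (U : graph V) g : pair_colouring U g ->
  (forall x y z, adj U x y -> adj U x z -> ~ adj U y z) ->
  components_even_cycles_or_paths U.
Proof.
move=> [sg h _] tf.
have uniq x y z : adj U x y -> adj U x z -> g x y = g x z -> y = z.
  by move=> xy xz e; apply: contrapT => n; apply: (h x y z) => //; exact: tf xz.
(* By [uniq] the neighbour is determined by its colour; the default [x] makes [m b] an
   involution. *)
pose m b x := if pselect (exists y, adj U x y /\ g x y = b) is left ex
              then sval (cid ex) else x.
have mE b x y : adj U x y -> g x y = b -> m b x = y.
  move=> xy gxy; rewrite /m; case: pselect => [ex|[]]; last by exists y.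
  by case: (svalP (cid ex)) => xz gxz; apply: (uniq x) => //; rewrite gxy.
have mP b x : m b x <> x -> adj U x (m b x) /\ g x (m b x) = b.
  by rewrite /m; case: pselect => // ex _; exact: svalP (cid ex).
apply: (@matchings_cycles_or_paths V U m).
- move=> b x; case: (pselect (m b x = x)) => [e|/mP[xy gxy]]; first by rewrite !e.
  by apply: mE; [exact: adj_sym|rewrite sg].
- move=> x e; apply: contrapT => n; have [_ gt] := mP _ _ n.
  by rewrite e in n gt; have [_] := mP _ _ n; rewrite gt.
- move=> x y; split=> [xy|[nxy [b mb]]]; last first.
    have n : m b x <> x by rewrite mb => /esym.
    by rewrite -mb; case: (mP b x n).
  by split; [exact: adj_neq xy|exists (g x y); exact: mE].
Qed.

(** * Colouring even cycles and paths *)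

(** What even cycles and all kinds of paths have in common, and all that the colouring needs: [s] is
    a partial injective successor map and [p] a parity along it. *)
Definition alternating V (C : set V) (U : graph V) (s : V -> V -> Prop) (p : V -> bool) : Prop :=
  [/\ forall x y z, C x -> C y -> C z -> s x y -> s x z -> y = z,
      forall x y z, C x -> C y -> C z -> s y x -> s z x -> y = z,
      forall x y, C x -> C y -> s x y -> p y = ~~ p x &
      forall x y, C x -> C y -> adj U x y -> s x y \/ s y x].

Lemma alternating_iso V W (C : set V) (U : graph V) (H : graph W) s p :
  isomorphic (induced U C) H -> alternating setT H s p ->
  exists s' p', alternating C U s' p'.
Proof.
move=> [f [/bij_inj f_inj fU]] [s1 s2 sp sa].
(* Quantifying over membership proofs makes [s'] and [p'] total; off [C] they are false. *)
pose s' x y := exists (hx : C x) (hy : C y), s (f (exist _ x hx)) (f (exist _ y hy)).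
pose p' x := `[< exists h : C x, p (f (exist _ x h)) >].
have s'E x y hx hy : s' x y <-> s (f (exist _ x hx)) (f (exist _ y hy)).
  split=> [[hx' [hy']]|]; last by exists hx, hy.
  by rewrite (Prop_irrelevance hx hx') (Prop_irrelevance hy hy').
have p'E x h : p' x = p (f (exist _ x h)).
  apply/asboolP/idP => [[h']|]; last by exists h.
  by rewrite (Prop_irrelevance h h').
exists s', p'; split.
- move=> x y z hx hy hz /(s'E _ _ hx hy) xy /(s'E _ _ hx hz) xz.
  by have /f_inj[] := s1 _ _ _ I I I xy xz.
- move=> x y z hx hy hz /(s'E _ _ hy hx) xy /(s'E _ _ hz hx) xz.
  by have /f_inj[] := s2 _ _ _ I I I xy xz.
- move=> x y hx hy /(s'E _ _ hx hy) xy.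
  by rewrite (p'E x hx) (p'E y hy); exact: sp.
- move=> x y hx hy xy; rewrite (s'E _ _ hx hy) (s'E _ _ hy hx).
  by apply: sa => //; apply/fU.
Qed.

Lemma succ_graph_alternating T (s : T -> T -> Prop) p :
  (forall x y z, s x y -> s x z -> y = z) -> (forall x y z, s y x -> s z x -> y = z) ->
  (forall x y, s x y -> p y = ~~ p x) -> alternating setT (succ_graph s) s p.
Proof.
by move=> s1 s2 sp; split=> [x y z _ _ _|x y z _ _ _|x y _ _|x y _ _ []//];
  [exact: s1|exact: s2|exact: sp].
Qed.

Lemma cycle_or_path_alternating V (C : set V) (U : graph V) :
  is_even_cycle (induced U C) \/ is_path (induced U C) ->
  exists s p, alternating C U s p.
Proof.
case=> [[n [n3 en iso]]|[[n [n1 iso]]|iso|iso]].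
- apply: (alternating_iso iso).
  apply: (@succ_graph_alternating _ _ (fun i : 'I_n => odd i)) => [x y z e e'|x y z e e'|x y ->].
  + by apply/val_inj; rewrite /= e e'.
  + apply/val_inj => /=; move: (ltn_ord y) (ltn_ord z).
    have : y.+1 = z.+1 %[mod n] by rewrite -e.
    by rewrite -!(addn1 (nat_of_ord _)) => /eqP; rewrite eqn_modDr => /eqP; rewrite !modn_small.
  (* Parity survives the wrap-around because [n] is even. *)
  + by rewrite odd_mod //; apply/negbTE.
- apply: (alternating_iso iso).
  apply: (@succ_graph_alternating _ _ (fun i : 'I_n => odd i)) => [x y z e e'|x y z e e'|x y ->//].
  + by apply/val_inj; rewrite /= e e'.
  + by apply/val_inj => /=; lia.
- apply: (alternating_iso iso).
  by apply: (@succ_graph_alternating _ _ odd) => [x y z|x y z|x y ->//]; lia.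
- apply: (alternating_iso iso).
  by apply: (@succ_graph_alternating _ _ (fun i : int => odd (absz i))) => [x y z|x y z|x y]; lia.
Qed.

(* A non-edge is coloured by whether its ends have the same parity, an edge by
   the parity of its initial end. *)
Lemma alternating_colouring V (U : graph V) s p :
  alternating setT U s p -> exists g, pair_colouring U g.
Proof.
move=> [s1 s2 sp sa].
pose e x y := `[< (s x y /\ p x) \/ (s y x /\ p y) >].
exists (fun x y => if `[< adj U x y >] then e x y else p x (+) p y).
apply: pair_colouringP => [x y|x y z nxy nxz nyz].
  rewrite asbool_adj_sym addbC; congr (if _ then _ else _).
  by apply/asbool_equiv_eq/or_comm.
rewrite /fan /kind /=; case: (asboolP (adj U x y)) => xy; case: (asboolP (adj U x z)) => xz;
  case: (asboolP (adj U y z)) => yz //=.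
  (* The edge leaving [x] has colour [p x]; the one entering has the colour of its initial end [w],
     of opposite parity. *)
  have eE v w : w <> v -> s x v -> s w x -> e x v = p x /\ e x w = ~~ p x.
    move=> nwv xv wx; have pw := sp _ _ I I wx; rewrite pw negbK; split; apply/asboolP/idP.
    - by case=> [[]|[vx _]]; [rewrite pw|case: nwv; apply: s2 wx vx].
    - by move=> h; left; rewrite pw.
    - by case=> [[xw _]|[]//]; case: nwv; apply: s1 xw xv.
    - by right.
  case: (sa _ _ I I xy) => hy; case: (sa _ _ I I xz) => hz.
  - by case: nyz; apply: s1 hy hz.
  - by have [-> ->] := eE y z (nesym nyz) hy hz; case: (p x).
  - by have [-> ->] := eE z y nyz hz hy; case: (p x).
  - by case: nyz; apply: s2 hy hz.
(* The remaining case has non-edges [xy], [xz] and an edge [yz], whose ends compare differently with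
   [x]. *)
have -> : p z = ~~ p y.
  by case: (sa _ _ I I yz) => /sp -> //; rewrite negbK.
by case: (p x); case: (p y).
Qed.

Lemma components_colouring V (U : graph V) :
  components_even_cycles_or_paths U -> exists g, pair_colouring U g.
Proof.
move=> compU.
have ex x : exists sp, alternating (component U x) U sp.1 sp.2.
  have [] := @cycle_or_path_alternating _ (component U x) U; first by apply: compU; exists x.
  by move=> s [p sp]; exists (s, p).
have exC (C : set V) : exists sp, is_component U C -> alternating C U sp.1 sp.2.
  case: (pselect (is_component U C)) => [[x ->]|nC]; last by exists (fun _ _ => True, xpredT).
  by case: (ex x) => sp h; exists sp.
(* The choice depends on the component as a set, so connected vertices share it. *)
pose F C := sval (cid (exC C)).
have FP x : alternating (component U x) U (F (component U x)).1 (F (component U x)).2.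
  by apply: (svalP (cid (exC (component U x)))); exists x.
have Kxx x : component U x x by exact: rt_refl.
pose s x y := component U x y /\ (F (component U x)).1 x y.
apply: (@alternating_colouring _ _ s (fun x => (F (component U x)).2 x)); split.
- move=> x y z _ _ _ [xy sxy] [xz sxz].
  by case: (FP x) => h _ _ _; apply: h sxy sxz.
- move=> x y z _ _ _ [yx syx] [zx szx]; case: (FP x) => _ h _ _.
  move: syx szx; rewrite (component_eq yx) (component_eq zx).
  by apply: h => //; exact: connected_sym.
- move=> x y _ _ [xy sxy]; rewrite -(component_eq xy).
  by case: (FP x) => _ _ h _; apply: h sxy.
- move=> x y _ _ xy; have cxy : component U x y by exact: rt_step.
  case: (FP x) => _ _ _ /(_ x y (Kxx x) cxy xy)[h|h]; [by left|right].
  by split; [exact: connected_sym|rewrite -(component_eq cxy)].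
Qed.

(** * The affine plane over F_3 *)

Notation plane := ('I_3 * 'I_3)%type.

(* Lines of the affine plane over F_3: the horizontal and vertical directions
   are the two colours of [P9], the two diagonal ones those of its complement. *)
Definition direction (p q : plane) : bool * bool :=
  let u := (p.1 == q.1) (+) (p.2 == q.2) in
  (u, if u then p.2 == q.2 else (p.1 + q.2) %% 3 == (p.2 + q.1) %% 3).

(** Closed ordinals let the case checks on points compute. *)
Lemma ord3_ind (P : 'I_3 -> Prop) :
  P (@Ordinal 3 0 isT) -> P (@Ordinal 3 1 isT) -> P (@Ordinal 3 2 isT) -> forall i, P i.
Proof.
by move=> P0 P1 P2 [[|[|[|//]]] h]; rewrite (bool_irrelevance h isT).
Qed.

Lemma adj_P9E p q : `[< adj P9 p q >] = (direction p q).1.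
Proof.
apply/asboolP/idP; rewrite /direction /=; case: eqP; case: eqP => //=; try tauto.
Qed.

(** If [pq] and [pr] have the same direction, the three points are collinear and [qr] has that
    direction too, so it cannot differ in adjacency. *)
Lemma P9_fan p q r : p != q -> p != r -> q != r ->
  fan (direction p q) (direction p r) (direction q r).
Proof.
case: p q r => [p1 p2] [q1 q2] [r1 r2].
by elim/ord3_ind: p1; elim/ord3_ind: p2; elim/ord3_ind: q1; elim/ord3_ind: q2;
  elim/ord3_ind: r1; elim/ord3_ind: r2.
Qed.

Lemma direction_sym p q : direction p q = direction q p.
Proof.
rewrite /direction (eq_sym p.1) (eq_sym p.2); congr (_, if _ then _ else _).
by rewrite eq_sym addnC (addnC p.1).
Qed.

Lemma embeds_in_P9_colouring V (U : graph V) :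
  embeds_in_P9 U -> exists g, pair_colouring U g.
Proof.
case=> W [f [/bij_inj f_inj fU]]; pose h x := sval (f x).
have h_inj : injective h by move=> x y /sval_inj/f_inj.
exists (fun x y => (direction (h x) (h y)).2); apply: pair_colouringP => [x y|].
  by rewrite direction_sym.
have kE x y : kind U (fun x y => (direction (h x) (h y)).2) x y = direction (h x) (h y).
  rewrite /kind (_ : `[< adj U x y >] = (direction (h x) (h y)).1); first by case: direction.
  by rewrite -adj_P9E; apply/asbool_equiv_eq/fU.
move=> x y z nxy nxz nyz; rewrite !kE.
by apply: P9_fan; apply/eqP => /h_inj.
Qed.

Lemma embeds_in_P9_inj V (U : graph V) (f : V -> plane) :
  injective f -> (forall x y, adj U x y <-> adj P9 (f x) (f y)) -> embeds_in_P9 U.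
Proof.
move=> f_inj fU; exists (range f).
have fR x : range f (f x) by exists x.
have ex (w : {p | range f p}) : exists x, f x = sval w.
  by case: (svalP w) => x _ e; exists x.
exists (fun x => exist _ (f x) (fR x)); split=> //.
exists (fun w => sval (cid (ex w))) => [x|w].
  exact/f_inj/(svalP (cid (ex _))).
exact/sval_inj/(svalP (cid (ex w))).
Qed.

(** * The bull in the plane and two finite checks *)

Notation i0 := (@Ordinal 3 0 isT).
Notation i1 := (@Ordinal 3 1 isT).
Notation i2 := (@Ordinal 3 2 isT).

(** The colours of edges and those of non-edges can be renamed independently, by [s] and [t]. *)
Definition flip (s t : bool) (k : bool * bool) : bool * bool :=
  (k.1, k.2 (+) (if k.1 then s else t)).

(** Boolean quantifiers, so that the finite checks are closed computations. *)
Definition allb (P : bool -> bool) := P true && P false.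

Lemma allbP P : allb P -> forall b, P b.
Proof. by case/andP=> Pt Pf []. Qed.

Definition allk (P : bool * bool -> bool) := allb (fun a => allb (fun b => P (a, b))).

Lemma allkP P : allk P -> forall k, P k.
Proof. by move=> /allbP h [a b]; exact: (allbP (h a)). Qed.

(** The triangle [po], [pa], [pb] is a horizontal line and the independent triple [po], [pc], [pd] a
    diagonal one; the pendant edges [pa pc] and [pb pd] are vertical. *)
Definition po : plane := (i0, i0).
Definition pa : plane := (i1, i0).
Definition pb : plane := (i2, i0).
Definition pc : plane := (i1, i1).
Definition pd : plane := (i2, i2).
Definition bull_points := [:: po; pa; pb; pc; pd].
Definition other_points : seq plane := [:: (i0, i1); (i0, i2); (i1, i2); (i2, i1)].

(** Each entry of the list is a point together with the kind of the pair that it forms with one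
    further vertex. *)
Fixpoint consistent (K : plane -> plane -> bool * bool) (s : seq (plane * (bool * bool))) :=
  if s is qk :: s' then
    all (fun qk' => triangle_ok qk.2 qk'.2 (K qk.1 qk'.1)) s' && consistent K s'
  else true.

(** Of the [4 ^ 5] ways to attach a further vertex to the five points, those with admissible triples
    are the views from the points off the bull. *)
Lemma bull_extension_check :
  allb (fun s => allb (fun t =>
  allk (fun ko => allk (fun ka => allk (fun kb => allk (fun kc => allk (fun kd =>
    let K p q := flip s t (direction p q) in
    let ks := [:: (po, ko); (pa, ka); (pb, kb); (pc, kc); (pd, kd)] in
    consistent K ks ==>
      has (fun p => all (fun qk => qk.2 == K p qk.1) ks) other_points))))))).
Proof. by vm_compute. Qed.

(** For two vertices off the bull, their triples with the five points already decide adjacency and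
    exclude a common position. *)
Lemma other_pair_check :
  allb (fun s => allb (fun t => allk (fun k =>
    let K p q := flip s t (direction p q) in
    all (fun p => all (fun p' =>
      all (fun q => triangle_ok k (K p q) (K p' q)) bull_points ==>
        (p != p') && (k.1 == (direction p p').1)) other_points) other_points))).
Proof. by vm_compute. Qed.

(** * Coordinates from a bull *)

Section Bull.

Variables (V : Type) (U : graph V) (g : V -> V -> bool).
Hypothesis gU : pair_colouring U g.

Notation u x y := `[< adj U x y >].
Notation k := (kind U g).

Lemma neq_by_adj x y z : u x y -> ~~ u x z -> y <> z.
Proof. by move=> xy xz e; move: xz; rewrite -e xy. Qed.

Section BullPlane.

Variables (o a b c d : V).
Hypotheses (oa : u o a) (ob : u o b) (ab : u a b) (ac : u a c) (bd : u b d).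
Hypotheses (oc : ~~ u o c) (od : ~~ u o d) (cd : ~~ u c d) (ad : ~~ u a d) (bc : ~~ u b c).
Hypotheses (noc : o <> c) (nod : o <> d) (ncd : c <> d).

Let bull : seq (V * plane) := [:: (o, po); (a, pa); (b, pb); (c, pc); (d, pd)].

(** In the plane both [po pa] and [po pc] have colour [true]; the renamings [s] and [t] turn this
    into the actual colours of [oa] and [oc]. *)
Let s := g o a (+) true.
Let t := g o c (+) true.
Let K p q := flip s t (direction p q).

Let bull_vertex x := exists q, List.In (x, q) bull.

Lemma bull_distinct : [/\ o <> a, o <> b & a <> b] /\ [/\ a <> c, a <> d, b <> c & b <> d].
Proof.
have ne x y : u x y -> x <> y by move/asboolP; exact: adj_neq.
by split; split; auto; exact: neq_by_adj oc || exact: neq_by_adj od.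
Qed.

(** The triples of a bull propagate the colours of [oa] and [oc] to all ten pairs. *)
Lemma bull_kinds :
  [/\ k o a = K po pa, k o b = K po pb, k o c = K po pc & k o d = K po pd] /\
  [/\ k a b = K pa pb, k a c = K pa pc & k a d = K pa pd] /\
  [/\ k b c = K pb pc, k b d = K pb pd & k c d = K pc pd].
Proof.
have [[noa nob nab] [nac nad nbc nbd]] := bull_distinct.
have := kind_triangle gU noa nob nab.
have := kind_triangle gU noa noc nac.
have := kind_triangle gU noa nod nad.
have := kind_triangle gU nob noc nbc.
have := kind_triangle gU nob nod nbd.
have := kind_triangle gU noc nod ncd.
have := kind_triangle gU nab nac nbc.
have := kind_triangle gU nab nad nbd.
have := kind_triangle gU nac nad ncd.
have := kind_triangle gU nbc nbd ncd.
rewrite /K /s /t /kind oa ob ab ac bd.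
rewrite (negbTE oc) (negbTE od) (negbTE cd) (negbTE ad) (negbTE bc).
rewrite /triangle_ok /fan /=.
by case: (g o a); case: (g o b); case: (g a b); case: (g a c); case: (g b d) => //=;
  case: (g o c); case: (g o d); case: (g c d); case: (g a d); case: (g b c) => //=.
Qed.

(* [v] plays the role of the point [p] of the plane, as far as the bull can tell. *)
Let sits v p := forall x q, List.In (x, q) bull ->
  (x = v <-> q = p) /\ (x <> v -> k v x = K p q).

Lemma bull_sits x p : List.In (x, p) bull -> sits x p.
Proof.
have [[noa nob nab] [nac nad nbc nbd]] := bull_distinct.
have [[k1 k2 k3 k4] [[k5 k6 k7] [k8 k9 k10]]] := bull_kinds.
have Ks : forall q r, K q r = K r q by move=> q r; rewrite /K direction_sym.
have ks : forall y z, k y z = k z y by move=> y z; exact: kind_sym.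
(* Bundled equations serve as one rewriting rule, from which the applicable one is picked. *)
pose kk := (k1, k2, k3, k4, k5, k6, k7, k8, k9, k10).
move=> xp y q yq.
by case: xp => [[<- <-]|[[<- <-]|[[<- <-]|[[<- <-]|[[<- <-]|[]]]]]];
  case: yq => [[<- <-]|[[<- <-]|[[<- <-]|[[<- <-]|[[<- <-]|[]]]]]];
  (split; [by split=> // /esym|move=> n; by [|rewrite kk|rewrite ks Ks kk]]).
Qed.

Lemma other_sits v : ~ bull_vertex v ->
  exists p, p \in other_points /\ sits v p.
Proof.
move=> nv.
have [[noa nob nab] [nac nad nbc nbd]] := bull_distinct.
have [[k1 k2 k3 k4] [[k5 k6 k7] [k8 k9 k10]]] := bull_kinds.
have nvo : v <> o by move=> e; apply: nv; exists po; rewrite e /=; tauto.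
have nva : v <> a by move=> e; apply: nv; exists pa; rewrite e /=; tauto.
have nvb : v <> b by move=> e; apply: nv; exists pb; rewrite e /=; tauto.
have nvc : v <> c by move=> e; apply: nv; exists pc; rewrite e /=; tauto.
have nvd : v <> d by move=> e; apply: nv; exists pd; rewrite e /=; tauto.
have := allkP (allkP (allkP (allkP (allkP (allbP (allbP bull_extension_check s) t)
  (k v o)) (k v a)) (k v b)) (k v c)) (k v d).
rewrite -/K => /implyP.
have -> : consistent K [:: (po, k v o); (pa, k v a); (pb, k v b); (pc, k v c); (pd, k v d)].
  rewrite [consistent _ _]/= -k1 -k2 -k3 -k4 -k5 -k6 -k7 -k8 -k9 -k10.
  by rewrite !(kind_triangle gU).
move=> /(_ isT)/hasP[p po_ /allP H]; exists p; split=> // x q xq.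
have kq : k v x = K p q.
  apply/eqP; case: xq => [[<- <-]|[[<- <-]|[[<- <-]|[[<- <-]|[[<- <-]|[]]]]]].
  - by apply: (H (po, k v o)); rewrite !inE eqxx ?orbT.
  - by apply: (H (pa, k v a)); rewrite !inE eqxx ?orbT.
  - by apply: (H (pb, k v b)); rewrite !inE eqxx ?orbT.
  - by apply: (H (pc, k v c)); rewrite !inE eqxx ?orbT.
  - by apply: (H (pd, k v d)); rewrite !inE eqxx ?orbT.
(* Both equalities are false, as [v] is off the bull and [p] off its points. *)
split=> //; split=> e.
  by case: nv; exists q; rewrite -e.
have : q \in other_points by rewrite e.
by case: xq => [[_ <-]|[[_ <-]|[[_ <-]|[[_ <-]|[[_ <-]|[]]]]]].
Qed.

(** If one vertex is on the bull, the position of the other already records their relation;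
    otherwise [other_pair_check] decides. *)
Lemma sits_adj v v' p p' : sits v p -> sits v' p' ->
  (~ bull_vertex v -> p \in other_points) -> (~ bull_vertex v' -> p' \in other_points) ->
  v <> v' -> p <> p' /\ u v v' = (direction p p').1.
Proof.
move=> vp vp' po_ po_' nvv'.
have bullcase w w' r r' : sits w r -> sits w' r' -> bull_vertex w' -> w <> w' ->
    r <> r' /\ u w w' = (direction r r').1.
  move=> wr wr' [q wq] nww'; have [[e _] _] := wr' _ _ wq.
  have <- := e erefl; have [[_ e1] e2] := wr _ _ wq; split=> [/esym/e1/esym//|].
  by have /(congr1 fst) := e2 (nesym nww').
case: (pselect (bull_vertex v')) => [bv'|nv'].
  exact: bullcase vp vp' bv' nvv'.
case: (pselect (bull_vertex v)) => [bv|nv].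
  case: (bullcase _ _ _ _ vp' vp bv (nesym nvv')) => n e.
  by split=> [/esym//|]; rewrite asbool_adj_sym e direction_sym.
have := allkP (allbP (allbP other_pair_check s) t) (k v v').
rewrite -/K => /allP/(_ p (po_ nv))/allP/(_ p' (po_' nv')).
have H x q : List.In (x, q) bull -> triangle_ok (k v v') (K p q) (K p' q).
  move=> xq.
  have n w : ~ bull_vertex w -> x <> w by move=> nw e; apply: nw; exists q; rewrite -e.
  case: (vp x q xq) => _ <-; last exact: n.
  case: (vp' x q xq) => _ <-; last exact: n.
  by apply: (kind_triangle gU) => //; apply/nesym/n.
have -> : all (fun q => triangle_ok (k v v') (K p q) (K p' q)) bull_points.
  rewrite /= andbT; apply/and5P; split;
    [apply: (H o)|apply: (H a)|apply: (H b)|apply: (H c)|apply: (H d)] => /=; tauto.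
by case/andP=> /eqP n /eqP e.
Qed.

Lemma bull_embeds_in_P9 : embeds_in_P9 U.
Proof.
have ex v : exists p, sits v p /\ (~ bull_vertex v -> p \in other_points).
  case: (pselect (bull_vertex v)) => [[q vq]|nv].
    by exists q; split=> [|[]]; [exact: bull_sits|exists q].
  by case: (other_sits nv) => p [po_ vp]; exists p.
pose f v := sval (cid (ex v)); have fP v := svalP (cid (ex v)).
have fE v v' : v <> v' -> f v <> f v' /\ u v v' = (direction (f v) (f v')).1.
  by case: (fP v) (fP v') => h1 h2 [h1' h2']; exact: sits_adj.
apply: (@embeds_in_P9_inj _ _ f) => [v v' e|v v'].
  by apply: contrapT => /fE[].
case: (pselect (v = v')) => [->|/fE[_ e]].
  by split=> h; case: (adj_irr h).
rewrite -adj_P9E in e.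
by split=> h; apply/asboolP; [rewrite -e|rewrite e]; apply/asboolP.
Qed.

End BullPlane.

(** Admissible triples force the edges between [a], [b] and [c], [d] to form a perfect matching, so
    this is a bull up to exchanging [c] and [d]. *)
Lemma shared_embeds_in_P9 o a b c d : u o a -> u o b -> u a b ->
  ~~ u o c -> ~~ u o d -> ~~ u c d -> o <> c -> o <> d -> c <> d -> embeds_in_P9 U.
Proof.
move=> oa ob ab oc od cd noc nod ncd.
have ne x y : u x y -> x <> y by move/asboolP; exact: adj_neq.
have [nac nad] : a <> c /\ a <> d by split; apply: neq_by_adj oa _.
have [nbc nbd] : b <> c /\ b <> d by split; apply: neq_by_adj ob _.
have [noa nob nab] : [/\ o <> a, o <> b & a <> b] by split; exact: ne.
have us x y : u x y = u y x by exact: asbool_adj_sym.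
have T := kind_triangle gU.
have : (u a c && u b d && ~~ u a d && ~~ u b c) || (u a d && u b c && ~~ u a c && ~~ u b d).
  move: (T _ _ _ noa nob nab) (T _ _ _ noa noc nac) (T _ _ _ noa nod nad)
    (T _ _ _ nob noc nbc) (T _ _ _ nob nod nbd) (T _ _ _ noc nod ncd)
    (T _ _ _ nab nac nbc) (T _ _ _ nab nad nbd) (T _ _ _ nac nad ncd)
    (T _ _ _ nbc nbd ncd).
  rewrite /kind oa ob ab (negbTE oc) (negbTE od) (negbTE cd) /triangle_ok /fan /=.
  by case: (u a c); case: (u a d); case: (u b c); case: (u b d) => //=;
  case: (g o a); case: (g o b); case: (g a b) => //=; case: (g a c); case: (g b d) => //=;
  case: (g o c); case: (g o d); case: (g c d) => //=; case: (g a d); case: (g b c) => //=.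
case/orP=> /andP[/andP[/andP[h1 h2] h3] h4].
  exact: (@bull_embeds_in_P9 o a b c d).
apply: (@bull_embeds_in_P9 o a b d c) => //; first by rewrite us.
exact: nesym.
Qed.

(** If no triangle meets an independent triple, each of [x], [y], [z] has at most one non-neighbour
    among [p], [q], [r], hence at least six edges join the two triples. But each of [p], [q], [r]
    has at most one neighbour in the triangle, which allows only three. *)
Lemma triangles_embeds_in_P9 x y z p q r : u x y -> u x z -> u y z ->
  ~~ u p q -> ~~ u p r -> ~~ u q r -> p <> q -> p <> r -> q <> r -> embeds_in_P9 U.
Proof.
move=> xy xz yz pq pr qr npq npr nqr; apply: contrapT => nU.
have us v w : u v w = u w v by exact: asbool_adj_sym.
have ne v w : u v w -> v <> w by move/asboolP; exact: adj_neq.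
have S o a b c d : u o a -> u o b -> u a b ->
    ~~ u o c -> ~~ u o d -> ~~ u c d -> o <> c -> o <> d -> c <> d -> False.
  by move=> *; apply: nU; exact: (@shared_embeds_in_P9 o a b c d).
have [nxy nxz nyz] : [/\ x <> y, x <> z & y <> z] by split; exact: ne.
have [yx zx zy] : [/\ u y x, u z x & u z y] by rewrite !(us z) us.
have [qp rp rq] : [/\ ~~ u q p, ~~ u r p & ~~ u r q] by rewrite !(us r) us.
have [nqp nrp nrq] : [/\ q <> p, r <> p & r <> q] by split; exact: nesym.
have D1 v a b : u v a -> u v b -> u a b -> [/\ v <> p, v <> q & v <> r].
  by move=> va vb vab; split=> e; subst v; [apply: (S p a b q r)|
    apply: (S q a b p r)|apply: (S r a b p q)].
have [xp xq xr] := D1 x y z xy xz yz.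
have [yp yq yr] := D1 y x z yx yz xz.
have [zp zq zr] := D1 z x y zx zy xy.
have E w a b : u w a -> u w b -> u a b -> w <> p -> w <> q -> w <> r ->
    [&& u w p || u w q, u w p || u w r & u w q || u w r].
  move=> wa wb wab wp wq wr; apply/and3P; split; apply/norP => -[h h'];
    exact: (S w a b _ _ wa wb wab h h').
have F w c d : ~~ u w c -> ~~ u w d -> ~~ u c d -> w <> c -> w <> d -> c <> d ->
    [&& ~~ (u w x && u w y), ~~ (u w x && u w z) & ~~ (u w y && u w z)].
  move=> wc wd wcd *; apply/and3P; split; apply/andP => -[h h'];
    by [apply: (S w x y c d)|apply: (S w x z c d)|apply: (S w y z c d)].
have := E x y z xy xz yz xp xq xr; have := E y x z yx yz xz yp yq yr.
have := E z x y zx zy xy zp zq zr.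
have := F p q r pq pr qr npq npr nqr; have := F q p r qp qr pr nqp nqr npr.
have := F r p q rp rq pq nrp nrq npq.
rewrite !(us _ x) !(us _ y) !(us _ z).
by case: (u x p); case: (u x q); case: (u x r) => //;
  case: (u y p); case: (u y q); case: (u y r) => //;
  case: (u z p); case: (u z q); case: (u z r).
Qed.

End Bull.

(** * The structure theorem and the equivalences *)

Lemma colouring_structure V (U : graph V) g : pair_colouring U g ->
  embeds_in_P9 U \/
  components_even_cycles_or_paths U \/ components_even_cycles_or_paths (compl U).
Proof.
move=> gU.
case: (pselect (exists x y z, [/\ adj U x y, adj U x z & adj U y z])) => [tri|ntri]; last first.
  right; left; apply: (triangle_free_cycles_or_paths gU) => x y z xy xz yz.
  by apply: ntri; exists x, y, z.
case: (pselect (exists x y z,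
    [/\ adj (compl U) x y, adj (compl U) x z & adj (compl U) y z])) => [tri'|ntri]; last first.
  right; right; apply: (triangle_free_cycles_or_paths (pair_colouring_compl gU)) => x y z xy xz yz.
  by apply: ntri; exists x, y, z.
left; case: tri tri' => x [y [z [xy xz yz]]] [p [q [r [[npq pq] [npr pr] [nqr qr]]]]].
by apply: (triangles_embeds_in_P9 gU (x := x) (y := y) (z := z) (p := p) (q := q) (r := r)) => //;
  [exact/asboolP|exact/asboolP|exact/asboolP|exact/asboolPn|exact/asboolPn|exact/asboolPn].
Qed.

Theorem theorem2 (V : Type) (U : graph V) :
  ((exists G G' : graph V, same_3homogeneous G G' /\ U = bsum G G') <->
   (bipartite (edge_graph U) /\ bipartite (edge_graph (compl U)))) /\
  ((bipartite (edge_graph U) /\ bipartite (edge_graph (compl U))) <->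
   (embeds_in_P9 U \/
    components_even_cycles_or_paths U \/
    components_even_cycles_or_paths (compl U))).
Proof.
rewrite boolean_sum_pair_colouring bipartite_pair_colouring; split=> //; split.
  by case=> g; exact: colouring_structure.
case=> [|[]]; [exact: embeds_in_P9_colouring|exact: components_colouring|].
move=> /components_colouring[g gU]; exists g.
by rewrite -(complK U); exact: pair_colouring_compl.
Qed.
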